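(* Cut elimination for simple proof nets of classical logic, i.e., the reduction relation on simple prenets given by the rules (K1) and (K2), preserves correctness, is confluent, and is terminating.
   Context: Classical formulas: over atoms $a$, $\bar a$, $F ::= a\mid\bar a\mid F\vee F\mid F\wedge F$, with negation $\bar{\bar a}=a$, $\overline{A\wedge B}=\bar B\vee\bar A$, $\overline{A\vee B}=\bar B\wedge\bar A$. A simple prenet $\langle P\rangle\Gamma$ is a sequent forest $\Gamma$ (a list of formula trees, possibly with cuts, a cut being a tree with special root $A\oslash\bar A$ whose children are the trees of $A$ and $\bar A$) with a symmetric irreflexive relation $P$ (links) on its leaves relating only occurrences of dual atoms. A conjunctive pruning deletes, for every $\wedge$-node and every cut node, one of its two immediate subtrees, and restricts $P$ to the remaining leaves; $\langle P\rangle\Gamma$ is correct iff every conjunctive pruning retains at least one link. A simple proof net is a correct simple prenet. Cut reduction: (K1) a cut between $A\wedge B$ and $\bar B\vee\bar A$ is replaced by the two cuts $A\oslash\bar A$ and $B\oslash\bar B$ (links unchanged); (K2) for an atomic cut $x\oslash y$ ($x$ an occurrence of $a$, $y$ of $\bar a$), let $X$ be the set of leaves other than $y$ linked to $x$ and $Y$ the set of leaves other than $x$ linked to $y$; remove the cut node, $x$, $y$ and all links involving them, and add a link between every $u\in X$ and every $v\in Y$ (if not already present). ''Preserves correctness'' means that any reduct of a correct simple prenet is correct. *)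

(* Defs.v *)
From HB Require Import structures.
From Stdlib Require Export Relation_Operators.
From mathcomp Require Export all_boot finmap.
From mathcomp Require Import zify.

Set Implicit Arguments.
Unset Strict Implicit.
Unset Printing Implicit Defensive.

Local Open Scope fset_scope.

(* Binary and/or-trees with leaves in X, used both for formulas (X = literals)
   and for formula trees (X = leaf occurrences of literals). *)
Inductive tree (X : Type) : Type :=
| Leaf of X
| Or of tree X & tree X
| And of tree X & tree X.

Section TreeEq.
Variable X : eqType.

Fixpoint tree_encode (t : tree X) : GenTree.tree X :=
  match t with
  | Leaf x => GenTree.Leaf x
  | Or s u => GenTree.Node 0 [:: tree_encode s; tree_encode u]
  | And s u => GenTree.Node 1 [:: tree_encode s; tree_encode u]
  end.

Fixpoint tree_decode (g : GenTree.tree X) : option (tree X) :=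
  match g with
  | GenTree.Leaf x => Some (Leaf x)
  | GenTree.Node n [:: g1; g2] =>
      if (tree_decode g1, tree_decode g2) is (Some s, Some u) then
        Some (if n == 0 then Or s u else And s u)
      else None
  | _ => None
  end.

Lemma tree_encodeK : pcancel tree_encode tree_decode.
Proof. by elim=> //= s -> u ->. Qed.

HB.instance Definition _ := Equality.copy (tree X) (pcan_type tree_encodeK).

End TreeEq.

Fixpoint tree_map (X Y : Type) (f : X -> Y) (t : tree X) : tree Y :=
  match t with
  | Leaf x => Leaf (f x)
  | Or s u => Or (tree_map f s) (tree_map f u)
  | And s u => And (tree_map f s) (tree_map f u)
  end.

Fixpoint tree_leaves (X : Type) (t : tree X) : seq X :=
  match t with
  | Leaf x => [:: x]
  | Or s u | And s u => tree_leaves s ++ tree_leaves u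
  end.

Section Prenets.
Variable atom : eqType.

(* (true, a) is the atom a and (false, a) is its dual. *)
Definition literal : Type := (bool * atom)%type.
Definition dual_lit (l : literal) : literal := (~~ l.1, l.2).

Definition formula : Type := tree literal.

Fixpoint dual (A : formula) : formula :=
  match A with
  | Leaf l => Leaf (dual_lit l)
  | Or A B => And (dual B) (dual A)
  | And A B => Or (dual B) (dual A)
  end.

(* A leaf of a sequent forest carries, besides its literal, a name that
   identifies it as an occurrence; names are pairwise distinct in a prenet. *)
Definition leaf : Type := (nat * literal)%type.

Definition formula_of (t : tree leaf) : formula := tree_map snd t.

Inductive root_tree : Type :=
| Fml of tree leaf
| Cut of tree leaf & tree leaf.

Definition cut_ok (r : root_tree) : bool :=
  if r is Cut s t then formula_of t == dual (formula_of s) else true.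

Definition root_leaves (r : root_tree) : seq leaf :=
  match r with
  | Fml t => tree_leaves t
  | Cut s t => tree_leaves s ++ tree_leaves t
  end.

Definition forest : Type := seq root_tree.

Definition leaves (G : forest) : seq leaf := flatten (map root_leaves G).
Definition names (G : forest) : seq nat := map fst (leaves G).

(* A relation on leaves, as the finite set of pairs of related names. *)
Definition links : Type := {fset nat * nat}.

Definition dual_occ (G : forest) (x y : nat) : bool :=
  has (fun u => has (fun v => [&& u.1 == x, v.1 == y & v.2 == dual_lit u.2])
                    (leaves G)) (leaves G).

Definition is_prenet (G : forest) (P : links) : bool :=
  [&& all cut_ok G,
      uniq (names G),
      all (fun p => (p.2, p.1) \in P) P,
      all (fun p => p.1 != p.2) P
    & all (fun p => dual_occ G p.1 p.2) P].

Record simple_prenet : Type := SimplePrenet {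
  forest_of : forest;
  links_of : links;
  prenetP : is_prenet forest_of links_of
}.

(* A conjunction or cut node that has lost one of its subtrees is
   contracted to the remaining subtree. *)
Inductive tree_pruning : tree leaf -> tree leaf -> Prop :=
| prune_leaf x : tree_pruning (Leaf x) (Leaf x)
| prune_or s s' t t' : tree_pruning s s' -> tree_pruning t t' ->
    tree_pruning (Or s t) (Or s' t')
| prune_and_l s s' t : tree_pruning s s' -> tree_pruning (And s t) s'
| prune_and_r s t t' : tree_pruning t t' -> tree_pruning (And s t) t'.

Inductive root_pruning : root_tree -> root_tree -> Prop :=
| prune_fml t t' : tree_pruning t t' -> root_pruning (Fml t) (Fml t')
| prune_cut_l s s' t : tree_pruning s s' -> root_pruning (Cut s t) (Fml s')
| prune_cut_r s t t' : tree_pruning t t' -> root_pruning (Cut s t) (Fml t').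

Inductive conj_pruning : forest -> forest -> Prop :=
| prune_nil : conj_pruning [::] [::]
| prune_cons r r' G G' : root_pruning r r' -> conj_pruning G G' ->
    conj_pruning (r :: G) (r' :: G').

Definition restrict (P : links) (N : seq nat) : links :=
  [fset p in P | (p.1 \in N) && (p.2 \in N)].

Definition correct (p : simple_prenet) : Prop :=
  forall G, conj_pruning (forest_of p) G ->
    restrict (links_of p) (names G) != fset0.

(* The names other than y that are linked to x. *)
Definition linked_except (P : links) (x y : nat) : {fset nat} :=
  [fset p.2 | p in P & (p.1 == x) && (p.2 != y)].

Definition atomic_cut_links (P : links) (x y : nat) : links :=
  let X := linked_except P x y in
  let Y := linked_except P y x in
  [fset p in P | (p.1 \notin [:: x; y]) && (p.2 \notin [:: x; y])]
    `|` (X `*` Y) `|` (Y `*` X).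

(* The two constructors for compound cuts are the same rule (K1): a cut node is
   unordered, so the conjunction may be its left or its right child. *)
Inductive cut_step : forest -> links -> forest -> links -> Prop :=
| K1l G1 G2 P a b b' a' :
    cut_step (G1 ++ Cut (And a b) (Or b' a') :: G2) P
             (G1 ++ Cut a a' :: Cut b b' :: G2) P
| K1r G1 G2 P a b b' a' :
    cut_step (G1 ++ Cut (Or b' a') (And a b) :: G2) P
             (G1 ++ Cut a a' :: Cut b b' :: G2) P
| K2 G1 G2 P (x y : leaf) :
    cut_step (G1 ++ Cut (Leaf x) (Leaf y) :: G2) P
             (G1 ++ G2) (atomic_cut_links P x.1 y.1).

Implicit Types (G : forest) (P : links).

Lemma dual_litK : involutive (dual_lit).
Proof. by case=> b a; rewrite /dual_lit /= negbK. Qed.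

Lemma dualK : involutive (dual).
Proof. by elim=> [l|A IA B IB|A IA B IB] /=; rewrite ?dual_litK ?IA ?IB. Qed.

Lemma dual_occP G x y :
  reflect (exists2 l, (x, l) \in leaves G & (y, dual_lit l) \in leaves G)
          (dual_occ G x y).
Proof.
apply: (iffP hasP) => [[[u l] uG /hasP[[v m] vG]]|[l xG yG]].
  by move=> /= /and3P[/eqP <- /eqP <- /eqP E]; exists l; rewrite -?E.
by exists (x, l) => //; apply/hasP; exists (y, dual_lit l); rewrite //= !eqxx.
Qed.

Lemma leaves_cat G1 G2 : leaves (G1 ++ G2) = leaves G1 ++ leaves G2.
Proof. by rewrite /leaves map_cat flatten_cat. Qed.

Lemma leaves_cons r G : leaves (r :: G) = root_leaves r ++ leaves G.
Proof. by []. Qed.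

Lemma leaf_inj G x l m : uniq (names G) ->
  (x, l) \in leaves G -> (x, m) \in leaves G -> l = m.
Proof.
rewrite /names; elim: (leaves G) => //= -[y k] s IH /andP[ys us].
rewrite !inE => /predU1P[[? ?]|xs] /predU1P[[? ?]|xs']; subst => //.
- by case/negP: ys; apply/mapP; exists (y, m).
- by case/negP: ys; apply/mapP; exists (y, l).
exact: IH.
Qed.

Lemma linked_exceptP P x y u :
  (u \in linked_except P x y) = ((x, u) \in P) && (u != y).
Proof.
apply/imfsetP/andP => [[[a b]]|[xu uy]].
  by rewrite !inE /= => /and3P[? /eqP <- ?] ->.
by exists (x, u); rewrite //= !inE /= xu eqxx.
Qed.

(* Every reduct of a prenet is a prenet, and every cut of a prenet is a redex:
   cut_red, which relates bundled prenets, misses none of the reducts. *)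
Lemma cut_step_prenet G P G' P' :
  is_prenet G P -> cut_step G P G' P' -> is_prenet G' P'.
Proof.
have perm_prenet (H H' : forest) Q : all (cut_ok) H' ->
  perm_eq (leaves H) (leaves H') -> is_prenet H Q -> is_prenet H' Q.
  move=> okH' pH /and5P[_ uH sQ iQ dQ]; apply/and5P; split=> //.
    by rewrite /names -(perm_uniq (perm_map fst pH)).
  apply/allP => p /(allP dQ) /dual_occP[l ? ?]; apply/dual_occP.
  by exists l; rewrite -(perm_mem pH).
move=> GP st; case: st GP => {G P G' P'}.
- move=> G1 G2 P a b b' a' GP; apply: (perm_prenet _ _ _ _ _ GP).
    case/and5P: GP => + _ _ _ _; rewrite !all_cat /= => /and3P[-> + ->].
    by rewrite /formula_of /= => /eqP[-> ->]; rewrite !eqxx.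
  by apply/permP=> f; rewrite !leaves_cat !leaves_cons /= !count_cat; lia.
- move=> G1 G2 P a b b' a' GP; apply: (perm_prenet _ _ _ _ _ GP).
    case/and5P: GP => + _ _ _ _; rewrite !all_cat /= => /and3P[-> + ->].
    by rewrite /formula_of /= => /eqP[-> ->]; rewrite !dualK !eqxx.
  by apply/permP=> f; rewrite !leaves_cat !leaves_cons /= !count_cat; lia.
move=> G1 G2 P [x k] [y k'] /and5P[okG uG /allP sP /allP iP /allP dP] /=.
move: okG; rewrite all_cat /= => /and3P[ok1 kk' ok2].
have {}kk' : k' = dual_lit k by move: kk'; rewrite /formula_of /= => /eqP[].
set G := G1 ++ _ in uG dP *.
have mG u l : ((u, l) \in leaves G) =
    [|| (u, l) == (x, k), (u, l) == (y, k') | (u, l) \in leaves (G1 ++ G2)].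
  by rewrite /G !leaves_cat leaves_cons /= !mem_cat !inE; do !case: (_ \in _); rewrite ?orbT ?orbF.
have xG : (x, k) \in leaves G by rewrite mG eqxx.
have yG : (y, k') \in leaves G by rewrite mG eqxx orbT.
have inG' u l : (u, l) \in leaves G -> u \notin [:: x; y] ->
    (u, l) \in leaves (G1 ++ G2).
  rewrite mG !inE negb_or => /or3P[/eqP[-> _]|/eqP[-> _]|//];
  by rewrite eqxx ?andbF.
have mX u : u \in linked_except P x y ->
    u \notin [:: x; y] /\ (u, dual_lit k) \in leaves G.
  rewrite linked_exceptP => /andP[xu uy]; split.
    by rewrite !inE (negPf uy) orbF eq_sym (iP _ xu : x != u).
  by have /dual_occP[l /(leaf_inj uG xG) <-] := dP _ xu.
have mY v : v \in linked_except P y x ->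
    v \notin [:: x; y] /\ (v, k) \in leaves G.
  rewrite linked_exceptP => /andP[yv vx]; split.
    by rewrite !inE (negPf vx) /= eq_sym (iP _ yv : y != v).
  by have /dual_occP[l /(leaf_inj uG yG) <-] := dP _ yv; rewrite kk' dual_litK.
have neq u v : u \in linked_except P x y -> v \in linked_except P y x -> u != v.
  move=> /mX[_ uG'] /mY[_ vG]; apply/eqP=> uv; rewrite uv in uG'.
  have := leaf_inj uG uG' vG; rewrite /dual_lit => /(congr1 fst) /=.
  by case: k.1.
have memP u v : ((u, v) \in atomic_cut_links P x y) =
   [|| [&& (u, v) \in P, u \notin [:: x; y] & v \notin [:: x; y]],
      (u \in linked_except P x y) && (v \in linked_except P y x) |
      (u \in linked_except P y x) && (v \in linked_except P x y)].
  by rewrite /atomic_cut_links !in_fsetU !in_fsetM /= -orbA; congr orb; rewrite !inE /=.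
apply/and5P; split.
- by rewrite all_cat ok1.
- move: uG; rewrite /names /G !leaves_cat leaves_cons.
  apply: subseq_uniq; apply: map_subseq; apply: cat_subseq => //.
  exact: suffix_subseq.
- apply/allP=> -[u v] /=; rewrite !memP.
  case/or3P=> [/and3P[/sP /= -> -> ->]|/andP[-> ->]|/andP[-> ->]];
  by rewrite ?orbT.
- apply/allP=> -[u v] /=; rewrite !memP.
  case/or3P=> [/and3P[/iP //]|/andP[]|/andP[hv hu]]; first exact: neq.
  by rewrite eq_sym neq.
apply/allP=> -[u v] /=; rewrite !memP => H; apply/dual_occP; move: H.
case/or3P=> [/and3P[/dP /dual_occP[l ul vl] nu nv]|/andP[]|/andP[]].
- by exists l; apply: inG'.
- by move=> /mX[? ?] /mY[? ?]; exists (dual_lit k); rewrite ?dual_litK; apply: inG'.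
by move=> /mY[? ?] /mX[? ?]; exists k; apply: inG'.
Qed.

Lemma cut_step_progress G1 s t G2 P : is_prenet (G1 ++ Cut s t :: G2) P ->
  exists G' P', cut_step (G1 ++ Cut s t :: G2) P G' P'.
Proof.
move=> /and5P[+ _ _ _ _]; rewrite all_cat /= => /and3P[_ + _].
by rewrite /formula_of; case: s t => [x|a b|a b] [y|c d|c d] // _;
  do 2 eexists; constructor.
Qed.

Definition cut_red (p q : simple_prenet) : Prop :=
  cut_step (forest_of p) (links_of p) (forest_of q) (links_of q).

End Prenets.

Arguments cut_red {atom} p q.
Arguments correct {atom} p.

Definition preserves (T : Type) (R : T -> T -> Prop) (C : T -> Prop) : Prop :=
  forall p q, C p -> R p q -> C q.

Definition confluent (T : Type) (R : T -> T -> Prop) : Prop :=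
  forall p q r, clos_refl_trans T R p q -> clos_refl_trans T R p r ->
  exists s, clos_refl_trans T R q s /\ clos_refl_trans T R r s.

Definition terminating (T : Type) (R : T -> T -> Prop) : Prop :=
  well_founded (fun q p => R p q).

(* Main.v *)
Require Import Defs.
From Stdlib Require Import Operators_Properties Wf_nat.
From mathcomp Require Import zify.

(** Every pruning of a reduct is matched by a pruning of the redex that retains
    no more leaves, except that a pruning of the reduct of an atomic cut is
    matched by two prunings, one keeping [x] and one keeping [y]; a link at [x]
    and a link at [y] then compose to a link of the reduct.

    Two reductions of different cuts commute, which gives confluence by a strip
    lemma.  For two atomic cuts, a link of either composite arises from a path
    alternating between links and cuts; a path that crosses the same cut twice
    can be shortened when it crosses it in the same direction, and the opposite
    direction is impossible because no leaf is linked to both sides of a cut.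

    The number of nodes of the forest decreases by two at every step. *)

Set Implicit Arguments.
Unset Strict Implicit.
Unset Printing Implicit Defensive.

Local Open Scope fset_scope.

(** * Abstract rewriting: from a one-step diamond to confluence *)

Section Confluence.
Variables (T : Type) (R : T -> T -> Prop).
Local Notation Rs := (clos_refl_trans T R).

Hypothesis diamond : forall p q r,
  R p q -> R p r -> q = r \/ exists s, R q s /\ R r s.

(** The single step is pushed along the reduction sequence. It stays one step until the sequence
    itself performs it, and then it is absorbed; hence the alternative [r = s]. *)
Lemma diamond_strip p q r : Rs p r -> R p q ->
  exists s, Rs q s /\ (r = s \/ R r s).
Proof.
move=> pr; elim: (clos_rt_rt1n _ _ _ _ pr) q => {p r pr} [p|p p' r pp' p'r IH] q pq.
  by exists q; split; [apply: rt_refl|right].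
case: (diamond pp' pq) => [<-|[s [p's qs]]].
  by exists r; split; [apply: clos_rt1n_rt|left].
have [w [sw rw]] := IH _ p's; exists w; split=> //.
by apply: rt_trans sw; apply: rt_step.
Qed.

Lemma diamond_confluent : confluent R.
Proof.
move=> p q r pq; elim: (clos_rt_rt1n _ _ _ _ pq) r => {p q pq} [p|p p' q pp' _ IH] r pr.
  by exists r; split=> //; apply: rt_refl.
have [w [p'w rw]] := diamond_strip pr pp'.
have [s [qs ws]] := IH _ p'w; exists s; split=> //.
case: rw => [->//|rw]; apply: rt_trans ws; exact: rt_step.
Qed.

End Confluence.

(** Locates two redexes of one forest relative to each other. *)
Lemma cat_cons_eq_cases (T : Type) (r s : T) G1 G2 H1 H2 :
    G1 ++ r :: G2 = H1 ++ s :: H2 ->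
  [\/ [/\ G1 = H1, r = s & G2 = H2],
      exists K, H1 = G1 ++ r :: K /\ G2 = K ++ s :: H2
    | exists K, G1 = H1 ++ s :: K /\ H2 = K ++ r :: G2].
Proof.
elim: G1 H1 => [|g G1 IH] [|h H1] /= [].
- by move=> -> ->; constructor 1.
- by move=> <- ->; constructor 2; exists H1.
- by move=> -> <-; constructor 3; exists G1.
move=> <- /IH[[-> -> ->]|[K [-> ->]]|[K [-> ->]]].
- by constructor 1.
- by constructor 2; exists K.
by constructor 3; exists K.
Qed.

(** * The links produced by atomic cuts *)

Section AtomicCuts.
Implicit Types P : links.

(** Without self-links at [x] and [y], the sets [X] and [Y] avoid both cut leaves, so the four
    inequalities can be factored out of all three disjuncts. *)
Lemma in_atomic_cut_links P x y u v :
    (x, x) \notin P -> (y, y) \notin P ->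
  ((u, v) \in atomic_cut_links P x y) =
  [&& u != x, u != y, v != x, v != y &
     [|| (u, v) \in P, ((x, u) \in P) && ((y, v) \in P)
       | ((y, u) \in P) && ((x, v) \in P)]].
Proof.
move=> xx yy; rewrite /atomic_cut_links !in_fsetU !in_fsetM /= !linked_exceptP.
rewrite !inE /=.
have xN t : ((x, t) \in P) = (t != x) && ((x, t) \in P).
  by case: eqVneq => [->|]; rewrite ?(negPf xx).
have yN t : ((y, t) \in P) = (t != y) && ((y, t) \in P).
  by case: eqVneq => [->|]; rewrite ?(negPf yy).
rewrite (xN u) (xN v) (yN u) (yN v).
case: (u == x); case: (u == y); case: (v == x); case: (v == y) => //=;
  by rewrite ?andbF ?andbT ?orbF ?orbA.
Qed.

Lemma atomic_cut_links_comm P x y z w :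
    uniq [:: x; y; z; w] -> (forall u v, ((u, v) \in P) = ((v, u) \in P)) ->
    (forall u, (u, u) \notin P) ->
    (forall u, ~~ (((x, u) \in P) && ((y, u) \in P))) ->
    (forall u, ~~ (((z, u) \in P) && ((w, u) \in P))) ->
  atomic_cut_links (atomic_cut_links P x y) z w =
  atomic_cut_links (atomic_cut_links P z w) x y.
Proof.
rewrite /= !inE !negb_or => /and4P[/and3P[nxy nxz nxw] /andP[nyz nyw] nzw _].
move=> sP iP txy tzw.
(* A new self-link at [u] would need [u] to be linked to both sides of the cut. *)
have irr a b u : (forall t, ~~ (((a, t) \in P) && ((b, t) \in P))) ->
    (u, u) \notin atomic_cut_links P a b.
  move=> /(_ u) tu; rewrite in_atomic_cut_links // (negPf (iP u)) /=.
  by rewrite [X in _ || X]andbC (negPf tu) !andbF.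
apply/fsetP => -[u v]; rewrite [LHS]in_atomic_cut_links ?irr //.
rewrite [RHS]in_atomic_cut_links ?irr // !in_atomic_cut_links //.
have [nzx nzy] : z != x /\ z != y by rewrite ![z == _]eq_sym.
have [nwx nwy] : w != x /\ w != y by rewrite ![w == _]eq_sym.
rewrite nxz nxw nyz nyw nzx nzy nwx nwy /=.
(* Applied to the cut leaves themselves, the hypotheses make the links between the two cuts a
   partial matching. What is left is a finite check of booleans. *)
move: (txy z) (txy w) (tzw x) (tzw y).
rewrite (sP z x) (sP z y) (sP w x) (sP w y).
case: (u == x) (u == y) (u == z) (u == w) => [] [] [] [] //=; rewrite ?andbF //.
case: (v == x) (v == y) (v == z) (v == w) => [] [] [] [] //=; rewrite ?andbF //.
case: ((x, z) \in P) ((x, w) \in P) ((y, z) \in P) ((y, w) \in P)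
  => [] [] [] [] //= _ _ _ _; rewrite ?orbF ?andbF;
case: ((u, v) \in P) => //=;
case: ((x, u) \in P) ((y, u) \in P) ((z, u) \in P) ((w, u) \in P)
  => [] [] [] [] /=; rewrite ?orbT //=;
by case: ((x, v) \in P) ((y, v) \in P) ((z, v) \in P) ((w, v) \in P)
  => [] [] [] [].
Qed.

End AtomicCuts.

(** * Conjunctive prunings *)

Section CutReduction.
Variable atom : eqType.
Implicit Types (G H K : forest atom) (P : links) (r s : root_tree atom).
Implicit Types (t : tree (leaf atom)).

Lemma tree_pruning_leaves t t' : tree_pruning t t' ->
  {subset tree_leaves t' <= tree_leaves t}.
Proof.
elim=> {t t'} [l|s s' t t' _ IHs _ IHt|s s' t _ IH|s t t' _ IH] x //=;
  rewrite ?mem_cat.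
- by case/orP=> [/IHs->|/IHt->] //; rewrite orbT.
- by move=> /IH->.
by move=> /IH->; rewrite orbT.
Qed.

Lemma root_pruning_leaves r r' : root_pruning r r' ->
  {subset root_leaves r' <= root_leaves r}.
Proof.
case=> {r r'} [t t'|s s' t|s t t'] /tree_pruning_leaves sub x /sub //=;
  by rewrite mem_cat => ->; rewrite ?orbT.
Qed.

Lemma conj_pruning_leaves G G' : conj_pruning G G' ->
  {subset leaves G' <= leaves G}.
Proof.
elim=> {G G'} [|r r' G G' /root_pruning_leaves sub _ IH] x //.
by rewrite !leaves_cons !mem_cat => /orP[/sub->|/IH->] //; rewrite orbT.
Qed.

Lemma conj_pruning_cat G1 G2 G1' G2' :
  conj_pruning G1 G1' -> conj_pruning G2 G2' ->
  conj_pruning (G1 ++ G2) (G1' ++ G2').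
Proof. by move=> p1 p2; elim: p1 => //= *; constructor. Qed.

Lemma conj_pruning_catE G1 G2 G' : conj_pruning (G1 ++ G2) G' ->
  exists G1' G2',
    [/\ G' = G1' ++ G2', conj_pruning G1 G1' & conj_pruning G2 G2'].
Proof.
elim: G1 G' => [|r G1 IH] G' /= pG.
  by exists [::], G'; split=> //; constructor.
inversion_clear pG as [|? r' ? G'' pr pG'].
have [G1' [G2' [-> p1 p2]]] := IH _ pG'.
by exists (r' :: G1'), G2'; split=> //; constructor.
Qed.

(** * Retained links, and correctness under (K1) *)

Lemma restrict_neq0P P (N : seq nat) :
  reflect (exists u v, [/\ (u, v) \in P, u \in N & v \in N])
          (restrict P N != fset0).
Proof.
apply: (iffP (fset0Pn _)) => [[[u v]]|[u [v [uv uN vN]]]].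
  by rewrite !inE /= => /and3P[? ? ?]; exists u, v.
by exists (u, v); rewrite !inE /= uv uN vN.
Qed.

Lemma restrict_neq0_sub P (N N' : seq nat) : {subset N <= N'} ->
  restrict P N != fset0 -> restrict P N' != fset0.
Proof.
move=> sub /restrict_neq0P[u [v [uv /sub uN /sub vN]]].
by apply/restrict_neq0P; exists u, v.
Qed.

(** Unbundled form of [correct], in which the forest can change while the links stay fixed. *)
Definition links_correct G P : Prop :=
  forall G', conj_pruning G G' -> restrict P (names G') != fset0.

Lemma links_correct_pruning_sub G H P :
    (forall H', conj_pruning H H' ->
       exists2 G', conj_pruning G G' & {subset leaves G' <= leaves H'}) ->
  links_correct G P -> links_correct H P.
Proof.
move=> sub cG H' /sub[G' /cG cG' {}sub]; apply: restrict_neq0_sub cG' => u.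
by case/mapP=> l /sub lH ->; apply: map_f.
Qed.

(** A pruning acts on each root separately, so only the replaced part of the forest has to be
    compared. *)
Lemma pruning_sub_cat G1 G2 K H :
    (forall H', conj_pruning H H' ->
       exists2 K', conj_pruning K K' & {subset leaves K' <= leaves H'}) ->
  forall H', conj_pruning (G1 ++ H ++ G2) H' ->
    exists2 G', conj_pruning (G1 ++ K ++ G2) G' &
      {subset leaves G' <= leaves H'}.
Proof.
move=> sub L /conj_pruning_catE[G1' [L' [-> p1]]].
case/conj_pruning_catE=> [H' [G2' [-> /sub[K' pK subK] p2]]].
exists (G1' ++ K' ++ G2'); first by do 2?apply: conj_pruning_cat.
move=> l; rewrite !leaves_cat !mem_cat.
by case/or3P=> [->|/subK->|->]; rewrite ?orbT.
Qed.

Lemma cut_pruning (s t u : tree (leaf atom)) :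
  tree_pruning s u \/ tree_pruning t u -> conj_pruning [:: Cut s t] [:: Fml u].
Proof.
by case=> ?; constructor;
  [apply: prune_cut_l|constructor|apply: prune_cut_r|constructor].
Qed.

(** If one of the two cuts keeps its conjunct [a] or [b], prune the conjunction to it. Otherwise
    both keep the dual sides, which together form a pruning of the disjunction. *)
Lemma cut_and_or_pruning (a b b' a' : tree (leaf atom)) H' :
    conj_pruning [:: Cut a a'; Cut b b'] H' ->
  exists2 t, {subset tree_leaves t <= leaves H'} &
    tree_pruning (And a b) t \/ tree_pruning (Or b' a') t.
Proof.
move=> pH; inversion_clear pH as [|? r ? G1 pr pG1].
inversion_clear pG1 as [|? s ? G2 ps pG2]; inversion_clear pG2.
inversion_clear pr as [|? ta ? pa|? ? ta' pa'].
  exists ta; last by left; constructor.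
  by move=> l; rewrite !leaves_cons !mem_cat /= => ->.
inversion_clear ps as [|? tb ? pb|? ? tb' pb'].
  exists tb; last by left; constructor.
  by move=> l; rewrite !leaves_cons !mem_cat /= => ->; rewrite orbT.
exists (Or tb' ta'); last by right; constructor.
by move=> l; rewrite !leaves_cons !mem_cat /= => /orP[]->; rewrite ?orbT.
Qed.

(** * Correctness under (K2) *)

Lemma prenet_links_sym G P : is_prenet G P ->
  forall u v, ((u, v) \in P) = ((v, u) \in P).
Proof.
by case/and5P=> _ _ /allP sP _ _ u v; apply/idP/idP=> /sP.
Qed.

Lemma prenet_links_irr G P : is_prenet G P -> forall u, (u, u) \notin P.
Proof.
by case/and5P=> _ _ _ /allP iP _ u; apply/negP=> /iP /=; rewrite eqxx.
Qed.

(** A leaf linked to both sides would carry a literal and also its dual, and these differ in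
    sign. *)
Lemma prenet_atomic_cut G1 G2 P (x y : leaf atom) :
    is_prenet (G1 ++ Cut (Leaf x) (Leaf y) :: G2) P ->
  forall u, ~~ (((x.1, u) \in P) && ((y.1, u) \in P)).
Proof.
case/and5P=> okG uG _ _ /allP dP u; apply/negP=> /andP[xu yu].
move: okG; rewrite all_cat /= => /and3P[_ + _].
rewrite /formula_of /= => /eqP[yx].
have xG : (x.1, x.2) \in leaves (G1 ++ Cut (Leaf x) (Leaf y) :: G2).
  by rewrite leaves_cat leaves_cons !mem_cat !inE -surjective_pairing eqxx orbT.
have yG : (y.1, y.2) \in leaves (G1 ++ Cut (Leaf x) (Leaf y) :: G2).
  by rewrite leaves_cat leaves_cons !mem_cat !inE -surjective_pairing eqxx !orbT.
have /dual_occP[l /(leaf_inj uG xG) <- ux] := dP _ xu.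
have /dual_occP[m /(leaf_inj uG yG) <- uy] := dP _ yu.
have := leaf_inj uG ux uy; rewrite yx => /(congr1 fst) /=.
by case: (x.2.1).
Qed.

Lemma links_correct_atomic_cut G1 G2 P (x y : leaf atom) :
    is_prenet (G1 ++ Cut (Leaf x) (Leaf y) :: G2) P ->
    links_correct (G1 ++ Cut (Leaf x) (Leaf y) :: G2) P ->
  links_correct (G1 ++ G2) (atomic_cut_links P x.1 y.1).
Proof.
move=> pG cG H' pH; have sP := prenet_links_sym pG.
have iP := prenet_links_irr pG.
(* Names are distinct in the redex, so those of the cut leaves cannot recur in the remaining
   forest. *)
have [nx ny] : x.1 \notin names H' /\ y.1 \notin names H'.
  have : uniq (x.1 :: y.1 :: names (G1 ++ G2)).
    case/and5P: pG => _ + _ _ _; rewrite /names.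
    rewrite -(perm_uniq (s1 := map fst (x :: y :: leaves (G1 ++ G2)))) //.
    apply: perm_map; rewrite !leaves_cat leaves_cons /=.
    by apply/permP=> f; rewrite /= !count_cat /=; lia.
  rewrite /= inE negb_or => /and3P[/andP[_ nx] ny _].
  have sub : {subset names H' <= names (G1 ++ G2)}.
    by move=> u /mapP[l /(conj_pruning_leaves pH) lG ->]; apply: map_f.
  by split; [apply: contra nx|apply: contra ny]; apply: sub.
(* Reinserting the kept cut leaf [z] into [H'] gives a pruning of the redex. *)
have side z : conj_pruning [:: Cut (Leaf x) (Leaf y)] [:: Fml (Leaf z)] ->
    restrict P (z.1 :: names H') != fset0.
  have [G1' [G2' [-> p1 p2]]] := conj_pruning_catE pH => pz.
  have := cG _ (conj_pruning_cat p1 (conj_pruning_cat pz p2)).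
  apply: restrict_neq0_sub => u.
  by rewrite /names !leaves_cat inE !map_cat !mem_cat /= inE orbCA orbF.
(* The retained link avoids [z] or has exactly one end there, by irreflexivity. *)
have inner z : conj_pruning [:: Cut (Leaf x) (Leaf y)] [:: Fml (Leaf z)] ->
    (exists u v, [/\ (u, v) \in P, u \in names H' & v \in names H'])
    \/ exists2 u, (z.1, u) \in P & u \in names H'.
  move=> /side/restrict_neq0P[u [v []]]; rewrite !inE.
  case: (eqVneq u z.1) => [->|_] /=; case: (eqVneq v z.1) => [->|_] /=.
  - by rewrite (negPf (iP _)).
  - by move=> xv _ vN; right; exists v.
  - by move=> ux uN _; right; exists u; rewrite // sP.
  - by move=> uv uN vN; left; exists u, v.
have neq u : u \in names H' -> (u != x.1) && (u != y.1).
  by move=> uH; apply/andP; split;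
    [apply: contraNneq nx => <-|apply: contraNneq ny => <-].
apply/restrict_neq0P.
have keep u v : (u, v) \in P -> u \in names H' -> v \in names H' ->
    (u, v) \in atomic_cut_links P x.1 y.1.
  move=> uv /neq/andP[? ?] /neq/andP[? ?].
  by rewrite in_atomic_cut_links //; apply/and5P; split=> //; rewrite uv.
have [|[u [v [uv uN vN]]]|[u xu uN]] := inner x.
- by apply: cut_pruning; left; constructor.
- by exists u, v; rewrite keep.
have [|[u' [v [uv uN' vN]]]|[v yv vN]] := inner y.
- by apply: cut_pruning; right; constructor.
- by exists u', v; rewrite keep.
(* Neither pruning gave a link inside [H'], so the links at [x] and at [y] are composed across the
   cut. *)
exists u, v; split=> //; move: (neq u uN) (neq v vN) => /andP[? ?] /andP[? ?].
by rewrite in_atomic_cut_links //; apply/and5P; split=> //; rewrite xu yv orbT.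
Qed.

Lemma cut_step_correct G P G' P' : is_prenet G P -> cut_step G P G' P' ->
  links_correct G P -> links_correct G' P'.
Proof.
move=> + st; case: st => {G P G' P'} G1 G2 P.
- move=> a b b' a' _; apply: links_correct_pruning_sub.
  apply: (pruning_sub_cat (K := [:: _]) (H := [:: _; _])) => H'.
  move=> /cut_and_or_pruning[t sub pt]; exists [:: Fml t].
    exact: cut_pruning.
  by move=> l; rewrite leaves_cons /= cats0 => /sub.
- move=> a b b' a' _; apply: links_correct_pruning_sub.
  apply: (pruning_sub_cat (K := [:: _]) (H := [:: _; _])) => H'.
  move=> /cut_and_or_pruning[t sub pt]; exists [:: Fml t].
    by apply: cut_pruning; apply/or_comm.
  by move=> l; rewrite leaves_cons /= cats0 => /sub.
by move=> x y; apply: links_correct_atomic_cut.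
Qed.

(** * Commutation of reductions *)

(** The reduction of a single cut as a function: the roots that replace it and its effect on the
    links. Thus a cut has only one reduct, and commutation at different cuts becomes commutation of
    the link maps. *)
Definition contract r : option (forest atom * (links -> links)) :=
  match r with
  | Cut (And a b) (Or b' a') | Cut (Or b' a') (And a b) =>
      Some ([:: Cut a a'; Cut b b'], id)
  | Cut (Leaf x) (Leaf y) =>
      Some ([::], fun P => atomic_cut_links P x.1 y.1)
  | _ => None
  end.

Lemma cut_step_contract G1 r G2 P l f : contract r = Some (l, f) ->
  cut_step (G1 ++ r :: G2) P (G1 ++ l ++ G2) (f P).
Proof.
by case: r => // -[x|a b|a b] [y|c d|c d] //= [<- <-]; constructor.
Qed.

Lemma cut_step_contractE G P G' P' : cut_step G P G' P' ->
  exists G1 r G2 l f, [/\ G = G1 ++ r :: G2, contract r = Some (l, f),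
    G' = G1 ++ l ++ G2 & P' = f P].
Proof.
by case=> {G P G' P'} *; do 5 eexists; split; reflexivity.
Qed.

(** For (K1) the link map is the identity, so only a pair of atomic cuts needs an argument. *)
Lemma contract_comm G1 r K s G2 P l f m g :
    is_prenet (G1 ++ r :: K ++ s :: G2) P ->
    contract r = Some (l, f) -> contract s = Some (m, g) ->
  g (f P) = f (g P).
Proof.
move=> pG; case: r pG => // -[x|? ?|? ?] [y|? ?|? ?] pG //= [_ <-] //.
all: case: s pG => // -[z|? ?|? ?] [w|? ?|? ?] pG //= [_ <-] //.
apply: atomic_cut_links_comm.
- case/and5P: pG => _ + _ _ _; rewrite /names.
  have: subseq [:: x; y; z; w] (leaves (G1 ++
      Cut (Leaf x) (Leaf y) :: K ++ Cut (Leaf z) (Leaf w) :: G2)).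
    rewrite leaves_cat leaves_cons leaves_cat leaves_cons.
    apply: (cat_subseq (s1 := [::]) (s2 := [:: x; y; z; w])).
      exact: sub0seq.
    apply: (cat_subseq (s1 := [:: x; y])) => //.
    apply: (cat_subseq (s1 := [::])); first exact: sub0seq.
    by apply: (cat_subseq (s1 := [:: z; w]) (s2 := [::])); rewrite ?sub0seq.
  by move=> /(map_subseq fst) sub /(subseq_uniq sub).
- exact: prenet_links_sym pG.
- exact: prenet_links_irr pG.
- exact: prenet_atomic_cut pG.
apply: (@prenet_atomic_cut (G1 ++ Cut (Leaf x) (Leaf y) :: K) G2 _ z w).
by rewrite -catA.
Qed.

Lemma cut_red_diamond (p q r : simple_prenet atom) :
  cut_red p q -> cut_red p r -> q = r \/ exists w, cut_red q w /\ cut_red r w.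
Proof.
(* The validity proof is a boolean equation, hence irrelevant. *)
have prenet_eq (q' r' : simple_prenet atom) :
    forest_of q' = forest_of r' -> links_of q' = links_of r' -> q' = r'.
  case: q' r' => [G P h] [G' P' h'] /= eG eP; case: _ / eG h' => h'.
  by case: _ / eP h' => h'; congr SimplePrenet; apply: bool_irrelevance.
(* Stated with [s1] to the left of [s2]; the other order follows by exchanging the two reducts. *)
have disjoint (q' r' : simple_prenet atom) G1 s1 K s2 G2 l1 f1 l2 f2 :
    forest_of p = G1 ++ s1 :: K ++ s2 :: G2 ->
    contract s1 = Some (l1, f1) -> contract s2 = Some (l2, f2) ->
    forest_of q' = G1 ++ l1 ++ K ++ s2 :: G2 -> links_of q' = f1 (links_of p) ->
    forest_of r' = G1 ++ s1 :: K ++ l2 ++ G2 -> links_of r' = f2 (links_of p) ->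
    exists w, cut_red q' w /\ cut_red r' w.
  move=> eG c1 c2 eq eqP er erP; have pG := prenetP p; rewrite eG in pG.
  have comm := contract_comm pG c1 c2.
  (* The common reduct contracts both cuts; [comm] makes its links independent of the order. *)
  have st : cut_step (forest_of q') (links_of q')
      (G1 ++ l1 ++ K ++ l2 ++ G2) (f2 (links_of q')).
    by rewrite eq !(catA _ _ (_ :: _)) !(catA _ _ (l2 ++ _)); apply: cut_step_contract.
  exists (SimplePrenet (cut_step_prenet (prenetP q') st)); split=> //.
  by rewrite /cut_red /= er erP eqP comm; apply: cut_step_contract.
move=> /cut_step_contractE[G1 [s1 [G2 [l1 [f1 [eG c1 eq eqP]]]]]].
move=> /cut_step_contractE[H1 [s2 [H2 [l2 [f2 [eH c2 er erP]]]]]].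
have [[e1 es e2]|[K [e1 e2]]|[K [e1 e2]]] :=
  cat_cons_eq_cases (etrans (esym eG) eH).
- left; subst; move: c2; rewrite c1 => -[? ?]; subst.
  by apply: prenet_eq; rewrite ?eq ?eqP ?er ?erP.
- right; subst; apply: (disjoint _ _ _ _ _ _ _ _ _ _ _ eG c1 c2 eq eqP _ erP).
  by rewrite er -catA.
right; subst.
have [|s [? ?]] := disjoint _ _ _ _ _ _ _ _ _ _ _ eH c2 c1 er erP _ eqP.
  by rewrite eq -catA.
by exists s.
Qed.

(** * Termination measure *)

Fixpoint tree_size t : nat :=
  match t with
  | Leaf _ => 1
  | Or s u | And s u => (tree_size s + tree_size u).+1
  end.

(** The cut node itself is not counted, so the additional cut created by (K1) adds nothing and the
    loss of two connectives remains; (K2) loses two leaves. *)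
Definition root_size r : nat :=
  match r with
  | Fml t => tree_size t
  | Cut s t => tree_size s + tree_size t
  end.

Definition forest_size G : nat := sumn (map root_size G).

Lemma cut_step_size G P G' P' : cut_step G P G' P' ->
  forest_size G' < forest_size G.
Proof.
by case=> {G P G' P'} *; rewrite /forest_size !map_cat !sumn_cat /=; lia.
Qed.

End CutReduction.

Theorem theorem5p10 (atom : eqType) :
  preserves (@cut_red atom) correct
  /\ confluent (@cut_red atom)
  /\ terminating (@cut_red atom).
Proof.
split; [|split].
- by move=> p q cp pq; apply: cut_step_correct (prenetP p) pq cp.
- exact/diamond_confluent/cut_red_diamond.
apply: (well_founded_lt_compat _ (fun p => forest_size (forest_of p))) => q p.
by move/cut_step_size/ltP.
Qed.
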